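(* For every $t\in(0,1)$ there exist compact sets $K_1,K_2\subset\mathbb{C}$ such that $$\operatorname{cap}(K_1)=\operatorname{cap}(K_2)=t\quad\text{and}\quad \vartheta(K_1)\neq\vartheta(K_2).$$
   Context: For a complex polynomial $p$, its unit lemniscate is $\Lambda_p=\{z\in\mathbb{C}:|p(z)|<1\}$. For a compact set $K\subset\mathbb{C}$ and $n\in\mathbb{N}$ (with $n\ge 1$), $\mathscr{P}_n(K)$ denotes the set of monic polynomials of degree $n$ all of whose zeros lie in $K$, i.e. $p(z)=\prod_{j=1}^n(z-z_j)$ with $z_j\in K$ (repetitions allowed). Let $m$ be Lebesgue (area) measure on $\mathbb{C}$, and define $A_n(K)=\inf_{p\in\mathscr{P}_n(K)}m(\Lambda_p)$ and $\vartheta(K)=\inf_{n}A_n(K)$. The logarithmic capacity $\operatorname{cap}(K)$ is defined by $\log\operatorname{cap}(K)=\sup_{\mu\in\mathcal{P}(K)}\int_K U_\mu(z)\,d\mu(z)$, where $\mathcal{P}(K)$ is the set of Borel probability measures on $K$ and $U_\mu(z)=\int_K\log|z-w|\,d\mu(w)$ (with $\operatorname{cap}(K)=0$ if the supremum is $-\infty$). *)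

(* Defs.v *)
(* MathComp / MathComp-Analysis *)
From HB Require Import structures.
From mathcomp Require Import all_boot all_order all_algebra.
From mathcomp Require Import complex.
From mathcomp Require Import all_classical all_reals all_analysis.

Set Implicit Arguments.
Unset Strict Implicit.
Unset Printing Implicit Defensive.

Import Order.TTheory GRing.Theory Num.Theory.
Import numFieldNormedType.Exports.

Local Open Scope classical_set_scope.
Local Open Scope complex_scope.
Local Open Scope ring_scope.

(* The complex plane over R, with the topology of the modulus. *)
Definition Cplane (R : realType) := R[i]^o.

(* The complex plane with its Borel sigma-algebra. *)
Definition borelC (R : realType) := g_sigma_algebraType (@open (Cplane R)).

(* The modulus as an element of R; the norm `|z| of R[i] lives in R[i]. *)
Definition cmod (R : realType) (z : R[i]) : R := complex.Re `|z|.

(* Area measure: two-dimensional Lebesgue measure transported along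
   (x, y) |-> x + iy. *)
Definition area (R : realType) (A : set R[i]) : \bar R :=
  (lebesgue_measure \x lebesgue_measure)%E [set u : R * R | A (u.1 +i* u.2)].

Definition lemniscate (R : realType) (p : {poly R[i]}) : set R[i] :=
  [set z | cmod p.[z] < 1].

Definition monic_zeros_in (R : realType) (K : set R[i]) (n : nat) :
    set {poly R[i]} :=
  [set p | [/\ p \is monic, size p = n.+1 & forall z, root p z -> K z]].

Definition min_area (R : realType) (K : set R[i]) (n : nat) : \bar R :=
  ereal_inf [set area (lemniscate p) | p in monic_zeros_in K n].

Definition theta (R : realType) (K : set R[i]) : \bar R :=
  ereal_inf [set min_area K n | n in [set n : nat | (1 <= n)%N]].

(* [lne] has value -oo at 0, so the kernel is -oo on the diagonal. On a
   compact set the kernel is bounded above, so the integrals below are the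
   usual ones, with values in [-oo, +oo[. *)
Definition potential (R : realType) (K : set R[i])
    (mu : probability (borelC R) R) (z : R[i]) : \bar R :=
  (\int[mu]_(w in (K : set (borelC R))) lne (cmod (z - (w : R[i])))%:E)%E.

Definition log_energy (R : realType) (K : set R[i])
    (mu : probability (borelC R) R) : \bar R :=
  (\int[mu]_(z in (K : set (borelC R))) potential K mu z)%E.

(* A Borel probability measure on a compact set K is encoded as a Borel
   probability measure on the plane giving K full mass. *)
Definition prob_on (R : realType) (K : set R[i]) :
    set (probability (borelC R) R) :=
  [set mu | mu (K : set (borelC R)) = 1%:E].

(* As expeR -oo = 0, the capacity is 0 when the supremum is -oo. *)
Definition capacity (R : realType) (K : set R[i]) : \bar R :=
  expeR (ereal_sup [set log_energy K mu | mu in prob_on K]).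

(* Main.v *)
Require Import Defs.
From HB Require Import structures.
From mathcomp Require Import all_boot all_order all_algebra.
From mathcomp Require Import complex ring lra.
From mathcomp Require Import all_classical all_reals all_analysis.
From mathcomp Require Import measurable_realfun.
Import Order.TTheory GRing.Theory Num.Theory.
Import numFieldNormedType.Exports.
Set Implicit Arguments.
Unset Strict Implicit.
Unset Printing Implicit Defensive.
Local Open Scope classical_set_scope.
Local Open Scope complex_scope.
Local Open Scope ring_scope.

(** The sets are [K1], the circle of radius [s] centred at [0] with [s < 1]
    chosen so that its capacity is [t], and [K2], the union of [K1] with one
    far away point [L].

    - A point does not contribute to the capacity: a measure with an atom has
      energy [-oo], so the measures of finite energy on [K2] and on [K1] are
      the same (capacity_setU1).
    - All zeros of a polynomial of P_n([K1]) are at distance less than [1] from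
      every point of the disk of radius [1 - s], so the lemniscate contains this
      disk and theta [K1] is bounded from below (theta_ge).  On the other hand
      the lemniscate of [(z - s)(z - L)] lies in two disks of radius
      [2 / (L - s)], so theta [K2] is as small as desired (theta_le).

    The radius [s] exists because capacity is homogeneous (capacity_scale) and
    the unit circle has a finite capacity [c >= 1] (capacity_circle): then
    [s = t / c <= t].  Only this lower bound on [c] requires an argument.  It
    says that the normalized arc length has energy at least [0], and it follows
    from the self-similarity of this measure under [z |-> z ^ 2].  Write
    [u(z,w) = ln 2 - ln |z - w|], which is nonnegative on the circle.  From
    [a^2 - b^2 = (a - b)(a + b)] one gets [u(a,b) + u(a,-b) = u(a^2,b^2) + ln 2].
    If [a] and [b] are independent and uniform on the circle then so are [a],
    [-b] and also [a^2], [b^2]; hence the mean [V] of [u] satisfies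
    [2 V = V + ln 2], that is [V = ln 2], provided [V] is finite.  To avoid
    proving that [V] is finite, [u] is replaced by [min(u, n)].  The identity
    then becomes an inequality in the useful direction (min_gap_sqr), so that
    the truncated mean is at most [ln 2] for each [n] (int_trunc_gap_le), and
    monotone convergence concludes (int_gap_expi_le).

    Energies are manipulated only through the nonnegative kernel
    [gap M z w], which on a set of diameter at most [exp M] is
    [M - ln |z - w|]; by log_energyE the energy of [mu] is [M] minus the double
    integral of this kernel over the whole plane. *)

(** * The modulus and the Borel sets of the plane *)

Lemma cmodE (R : realType) (z : R[i]) :
  cmod z = Num.sqrt (complex.Re z ^+ 2 + complex.Im z ^+ 2).
Proof. by rewrite /cmod normc_def. Qed.

Lemma cmodC (R : realType) (z : R[i]) : (cmod z)%:C = `|z|.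
Proof. by rewrite cmodE normc_def. Qed.

Lemma cmod_ge0 (R : realType) (z : R[i]) : 0 <= cmod z.
Proof. by rewrite cmodE sqrtr_ge0. Qed.

Lemma cmodM (R : realType) (z w : R[i]) : cmod (z * w) = cmod z * cmod w.
Proof. by apply: (@complexI R); rewrite rmorphM /= !cmodC normrM. Qed.

Lemma cmodN (R : realType) (z : R[i]) : cmod (- z) = cmod z.
Proof. by rewrite /cmod normrN. Qed.

Lemma cmodD (R : realType) (z w : R[i]) : cmod (z + w) <= cmod z + cmod w.
Proof. by rewrite -lecR rmorphD /= (cmodC z) (cmodC w) (cmodC (z + w)) ler_normD. Qed.

Lemma sqr_cmod (R : realType) (z : R[i]) :
  cmod z ^+ 2 = complex.Re z ^+ 2 + complex.Im z ^+ 2.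
Proof. by rewrite cmodE sqr_sqrtr// addr_ge0 ?sqr_ge0. Qed.

Lemma norm_Re_le_cmod (R : realType) (z : R[i]) : `|complex.Re z| <= cmod z.
Proof.
rewrite -(@ler_pXn2r _ 2) ?nnegrE ?cmod_ge0// sqr_cmod real_normK ?num_real//.
by rewrite lerDl sqr_ge0.
Qed.

Lemma norm_Im_le_cmod (R : realType) (z : R[i]) : `|complex.Im z| <= cmod z.
Proof.
rewrite -(@ler_pXn2r _ 2) ?nnegrE ?cmod_ge0// sqr_cmod real_normK ?num_real//.
by rewrite lerDr sqr_ge0.
Qed.

Lemma cmod_le_norm (R : realType) (z : R[i]) :
  cmod z <= `|complex.Re z| + `|complex.Im z|.
Proof.
rewrite -(@ler_pXn2r _ 2) ?nnegrE ?cmod_ge0 ?addr_ge0// sqr_cmod sqrrD.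
rewrite !real_normK ?num_real// -addrA lerD2l lerDr mulrn_wge0//.
Qed.

Lemma continuous_Re (R : realType) : continuous (@complex.Re R : Cplane R -> R).
Proof.
move=> z; apply/(@cvgrPdist_lt _ _ _ _ (nbhs_filter (z : Cplane R))) => e e0.
have : nbhs (z : Cplane R) (ball (z : Cplane R) e%:C).
  by apply: nbhsx_ballx; rewrite ltcR.
apply: filterS => w; rewrite -ball_normE /= -cmodC ltcR.
apply: le_lt_trans; rewrite -raddfB; exact: norm_Re_le_cmod.
Qed.

Lemma continuous_Im (R : realType) : continuous (@complex.Im R : Cplane R -> R).
Proof.
move=> z; apply/(@cvgrPdist_lt _ _ _ _ (nbhs_filter (z : Cplane R))) => e e0.
have : nbhs (z : Cplane R) (ball (z : Cplane R) e%:C).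
  by apply: nbhsx_ballx; rewrite ltcR.
apply: filterS => w; rewrite -ball_normE /= -cmodC ltcR.
apply: le_lt_trans; rewrite -raddfB; exact: norm_Im_le_cmod.
Qed.

Lemma continuous_complex (R : realType) (T : topologicalType) (f g : T -> R) :
  continuous f -> continuous g ->
  continuous (fun x => f x +i* g x : Cplane R).
Proof.
move=> cf cg x; apply/cvgrPdist_lt => e; rewrite ltcE => /andP[/eqP ie e0].
have e20 : 0 < complex.Re e / 2 by rewrite divr_gt0.
have /cvgrPdist_lt/(_ _ e20) F := cf x; have /cvgrPdist_lt/(_ _ e20) G := cg x.
near=> y.
rewrite -cmodC (complexE e) ie mulr0 addr0 ltcR.
rewrite (le_lt_trans (cmod_le_norm _))// (splitr (complex.Re e)) ltrD//=.
  by near: y.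
by near: y.
Unshelve. all: by end_near. Qed.

Lemma measurable_borelC (R : realType) d (T : measurableType d)
    (f : T -> borelC R) :
  (forall A : set (Cplane R), open A -> measurable (f @^-1` A)) ->
  measurable_fun setT f.
Proof.
move=> fA; apply: (@measurability _ _ T (borelC R) setT f (@open (Cplane R))) => //.
by move=> _ [A oA <-]; rewrite setTI; exact: fA.
Qed.

Lemma continuous_measurable_borelC (R : realType) (f : borelC R -> borelC R) :
  continuous (f : Cplane R -> Cplane R) -> measurable_fun setT f.
Proof.
move=> cf; apply: measurable_borelC => A oA.
by apply: sub_sigma_algebra; apply: open_comp oA => x _; exact: cf.
Qed.
Lemma continuous_measurable_toR (R : realType) (f : Cplane R -> R) :
  continuous f -> measurable_fun setT (f : borelC R -> R).
Proof.
move=> cf; apply: (measurability _ (RGenOpens.measurableE R)).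
move=> _ [_ [a [b ->]] <-]; rewrite setTI.
apply: sub_sigma_algebra; apply: open_comp; last exact: interval_open.
by move=> x _; exact: cf.
Qed.

(** * Area of lemniscates *)

(** The real and imaginary parts of [p(x + iy)] are obtained from [x] and [y]
    by Horner's scheme. *)
Lemma measurable_horner (R : realType) (p : {poly R[i]}) :
  measurable_fun setT (fun u : R * R => complex.Re p.[u.1 +i* u.2]) /\
  measurable_fun setT (fun u : R * R => complex.Im p.[u.1 +i* u.2]).
Proof.
elim/poly_ind: p => [|p c [mRe mIm]].
  by split; under eq_fun do rewrite horner0 /=; exact: measurable_cst.
have E (u : R * R) : (p * 'X + c%:P).[u.1 +i* u.2] =
    ((complex.Re p.[u.1 +i* u.2] * u.1 - complex.Im p.[u.1 +i* u.2] * u.2 + complex.Re c) +i*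
     (complex.Re p.[u.1 +i* u.2] * u.2 + complex.Im p.[u.1 +i* u.2] * u.1 + complex.Im c)).
  rewrite hornerMXaddC; case: (p.[_]) => x y; case: (c) => a b.
  by apply/eqP; rewrite eq_complex /=; apply/andP; split; apply/eqP; ring.
split; under eq_fun do rewrite E /=.
- apply: measurable_funD => //; apply: measurable_funB; exact: measurable_funM.
- apply: measurable_funD => //; apply: measurable_funD; exact: measurable_funM.
Qed.

Lemma measurable_lemniscate (R : realType) (p : {poly R[i]}) :
  measurable [set u : R * R | lemniscate p (u.1 +i* u.2)].
Proof.
have [mRe mIm] := measurable_horner p.
have mc : measurable_fun setT (fun u : R * R => cmod p.[u.1 +i* u.2]).
  under eq_fun do rewrite cmodE.
  apply: (measurableT_comp (continuous_measurable_fun (@sqrt_continuous R))).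
  by apply: measurable_funD; apply: measurable_funX.
rewrite (_ : [set u | _] =
  (fun u : R * R => cmod p.[u.1 +i* u.2]) @^-1` `]-oo, 1[%classic); last first.
  by apply/seteqP; split => u /=; rewrite in_itv.
by rewrite -[X in measurable X]setTI; apply: mc => //.
Qed.

Definition square (R : realType) (a : R[i]) (r : R) : set (R * R) :=
  `]complex.Re a - r, complex.Re a + r[%classic `*`
  `]complex.Im a - r, complex.Im a + r[%classic.

Lemma measurable_square (R : realType) (a : R[i]) (r : R) : measurable (square a r).
Proof. by apply: measurableX. Qed.

Lemma area_square (R : realType) (a : R[i]) (r : R) : 0 < r ->
  ((lebesgue_measure \x lebesgue_measure) (square a r) = (4 * r ^+ 2)%:E)%E.
Proof.
move=> r0; rewrite /square.
set I := `]complex.Re a - r, complex.Re a + r[%classic.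
set J := `]complex.Im a - r, complex.Im a + r[%classic.
transitivity (lebesgue_measure I * lebesgue_measure J)%E.
  by apply: product_measure1E; exact: measurable_itv.
rewrite !lebesgue_measure_itv /= !lte_fin.
rewrite !ifT; [|lra|lra].
by rewrite -!EFinB -EFinM; congr EFin; ring.
Qed.

Lemma cmod_horner_prod_lt1 (R : realType) (z : R[i]) (rs : seq R[i]) :
  (forall a, a \in rs -> cmod (z - a) < 1) -> (0 < size rs)%N ->
  cmod (\prod_(a <- rs) ('X - a%:P)).[z] < 1.
Proof.
elim: rs => [//|a [|b rs] IH] H _.
  by rewrite big_seq1 hornerXsubC H// mem_head.
rewrite big_cons hornerM hornerXsubC cmodM.
have a1 : cmod (z - a) < 1 by apply: H; rewrite mem_head.
have : cmod (\prod_(a <- b :: rs) ('X - a%:P)).[z] < 1.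
  by apply: IH => // c cin; apply: H; rewrite inE cin orbT.
have := cmod_ge0 (z - a); have := cmod_ge0 (\prod_(a <- b :: rs) ('X - a%:P)).[z].
nra.
Qed.

Lemma monic_prod_roots (R : realType) (K : set R[i]) (n : nat) (p : {poly R[i]}) :
  monic_zeros_in K n p -> exists2 rs : seq R[i],
    p = \prod_(a <- rs) ('X - a%:P) & size rs = n /\ forall a, a \in rs -> K a.
Proof.
move=> [pm sp pK]; have [rs prs] := closed_field_poly_normal p.
move: prs; rewrite (monicP pm) scale1r => prs.
exists rs => //; split.
  by move: sp; rewrite prs size_prod_XsubC => -[].
by move=> a ars; apply: pK; rewrite prs root_prod_XsubC.
Qed.

(** Each lemniscate in the infimum contains the disk of radius [1 - s] around [0], and this
    disk contains the square of half side [(1 - s) / 2]. *)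
Lemma theta_ge (R : realType) (K : set R[i]) (s : R) : s < 1 ->
  (forall z, K z -> cmod z <= s) -> (((1 - s) ^+ 2)%:E <= theta K)%E.
Proof.
move=> s1 Ks; apply: le_ereal_inf_tmp => _ [n /= n1 <-].
apply: le_ereal_inf_tmp => _ [p /monic_prod_roots[rs -> [srs rsK]] <-].
have r0 : 0 < (1 - s) / 2 by lra.
rewrite /area (_ : (1 - s) ^+ 2 = 4 * ((1 - s) / 2) ^+ 2); last by field.
rewrite -(area_square 0 r0); apply: le_measure; rewrite ?inE.
- exact: measurable_square.
- exact: measurable_lemniscate.
move=> [x y] [] /=; rewrite !in_itv/= !sub0r !add0r -!ltr_norml => xr yr.
apply: cmod_horner_prod_lt1; last by rewrite srs.
move=> a ars; apply: (le_lt_trans (cmodD _ _)).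
rewrite cmodN; have := Ks _ (rsK _ ars); have := cmod_le_norm (x +i* y) => /=.
lra.
Qed.

(** The polynomial is [(z - a)(z - b)].  If both factors are at least [r] in
    modulus then, their sum being at least [|a - b| = 2 / r], one of them is at
    least [1 / r] and the product is at least [1].  So the lemniscate is covered
    by two squares of area [4 r^2]. *)
Lemma theta_le (R : realType) (K : set R[i]) (a b : R[i]) (r : R) :
  0 < r -> r * cmod (a - b) = 2 -> K a -> K b -> (theta K <= (8 * r ^+ 2)%:E)%E.
Proof.
move=> r0 rab Ka Kb; pose p := ('X - a%:P) * ('X - b%:P).
have pK : monic_zeros_in K 2 p.
  split.
  - by rewrite monicMr ?monicXsubC.
  - by rewrite size_monicM ?monicXsubC ?polyXsubC_eq0 ?size_XsubC.
  - by move=> z; rewrite rootM !root_XsubC => /orP[] /eqP ->.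
apply: (@le_trans _ _ (min_area K 2)); first by apply: ereal_inf_lbound; exists 2%N.
apply: (@le_trans _ _ (area (lemniscate p))); first by apply: ereal_inf_lbound; exists p.
rewrite (_ : 8 * r ^+ 2 = 4 * r ^+ 2 + 4 * r ^+ 2); last by ring.
rewrite EFinD -{1}(area_square a r0) -(area_square b r0).
apply: le_trans (measureU2 _ _ _); [|exact: measurable_square..].
apply: le_measure; rewrite ?inE.
- exact: measurable_lemniscate.
- by apply: measurableU; exact: measurable_square.
move=> [x y] /=; rewrite /lemniscate /= hornerM !hornerXsubC cmodM.
set z := x +i* y => zp.
have sq (c : R[i]) : cmod (z - c) < r -> square c r (x, y).
  move=> zc; split => /=; rewrite in_itv/=.
    by have := le_lt_trans (norm_Re_le_cmod _) zc; rewrite raddfB /= ltr_norml; lra.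
  by have := le_lt_trans (norm_Im_le_cmod _) zc; rewrite raddfB /= ltr_norml; lra.
have [za|za] := ltP (cmod (z - a)) r; first by left; exact: sq.
right; apply: sq; rewrite ltNge; apply/negP => zb.
have : cmod (a - b) <= cmod (z - a) + cmod (z - b).
  rewrite -[cmod (z - a)]cmodN (_ : a - b = - (z - a) + (z - b)) ?cmodD//; ring.
nra.
Qed.

(** * The logarithmic kernel and the energy *)

Lemma measurable_lne_EFin (R : realType) :
  measurable_fun setT (fun x : R => lne x%:E).
Proof.
apply: measurable_fun_ifT => //=.
- by apply: measurable_fun_ler.
- by apply/measurable_EFinP; exact: measurable_ln.
Qed.

(** On sets of diameter at most [exp M] the maximum has no effect; it makes the
    kernel nonnegative on the whole plane, so that integrals of it exist and
    do not have to mention the set. *)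
Definition gap (R : realType) (M : R) (z w : R[i]) : \bar R :=
  maxe 0%E (M%:E - lne (cmod (z - w))%:E)%E.

Lemma gap_ge0 (R : realType) (M : R) (z w : R[i]) : (0 <= gap M z w)%E.
Proof. by rewrite /gap le_max lexx. Qed.

Lemma measurable_cmodB (R : realType) :
  measurable_fun setT (fun p : borelC R * borelC R => cmod ((p.1 : R[i]) - p.2)).
Proof.
have mRe := continuous_measurable_toR (@continuous_Re R).
have mIm := continuous_measurable_toR (@continuous_Im R).
rewrite (_ : (fun p => _) = Num.sqrt \o (fun p : borelC R * borelC R =>
  (complex.Re (p.1 : R[i]) - complex.Re (p.2 : R[i])) ^+ 2 +
  (complex.Im (p.1 : R[i]) - complex.Im (p.2 : R[i])) ^+ 2)); last first.
  by apply/funext => p /=; rewrite cmodE !raddfB.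
apply: measurableT_comp; first exact: (continuous_measurable_fun (@sqrt_continuous R)).
apply: measurable_funD; apply: measurable_funX; apply: measurable_funB.
- exact: measurableT_comp mRe measurable_fst.
- exact: measurableT_comp mRe measurable_snd.
- exact: measurableT_comp mIm measurable_fst.
- exact: measurableT_comp mIm measurable_snd.
Qed.

Lemma measurable_gap (R : realType) (M : R) :
  measurable_fun setT (fun p : borelC R * borelC R => gap M p.1 p.2).
Proof.
apply: measurable_maxe => //; apply: emeasurable_funB => //.
exact: (measurableT_comp (@measurable_lne_EFin R) (@measurable_cmodB R)).
Qed.

Lemma measurable_gapr (R : realType) (M : R) (z : R[i]) :
  measurable_fun setT (gap M z : borelC R -> \bar R).
Proof.
have := @measurable_fun_pair2 _ _ _ (borelC R) (borelC R) _ _ z (@measurable_gap R M). exact.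
Qed.

Lemma measurable_int_gap (R : realType) (M : R) (mu : probability (borelC R) R) :
  measurable_fun setT (fun z : borelC R => \int[mu]_w gap M z w)%E.
Proof.
apply: (@measurable_fun_fubini_tonelli_F _ _ _ _ R mu _ (@measurable_gap R M)).
by move=> p; exact: gap_ge0.
Qed.

(** As [g] may have integral [+oo], linearity of the integral does not apply:
    in that case the negative part of [M - g] has integral [+oo] while its
    positive part is at most [|M|]. *)
Lemma integral_cstB d (T : measurableType d) (R : realType)
    (mu : {measure set T -> \bar R}) (D : set T) (M : R) (g : T -> \bar R) :
  measurable D -> mu D = 1%E -> measurable_fun D g ->
  (forall x, D x -> 0 <= g x)%E ->
  (\int[mu]_(x in D) (M%:E - g x) = M%:E - \int[mu]_(x in D) g x)%E.
Proof.
move=> mD muD mg g0.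
have iM (k : R) : (\int[mu]_(x in D) k%:E = k%:E)%E.
  by rewrite (integral_cst mu mD k%:E) muD mule1.
have [goo|] := ltP (\int[mu]_(x in D) g x)%E +oo%E.
  rewrite (@integralB _ _ _ mu D mD (cst M%:E) g) ?iM//.
    apply/integrableP; split; first exact: measurable_cst.
    by rewrite [X in (X < _)%E](iM `|M|) ltry.
  apply/integrableP; split => //; rewrite (eq_integral g)// => x.
  by rewrite inE => Dx; rewrite gee0_abs// g0.
rewrite leye_eq => /eqP goo; rewrite goo /=.
rewrite [LHS]integralE.
set f := (fun x => M%:E - g x)%E.
have mf : measurable_fun D f by apply: emeasurable_funB.
have fp : (\int[mu]_(x in D) f^\+ x <= `|M|%:E)%E.
  rewrite -(iM `|M|); apply: ge0_le_integral => //.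
  - by apply: measurable_funepos.
  - move=> x Dx; rewrite funeposE ge_max lee_fin normr_ge0 andbT.
    rewrite /f; move: (g0 x Dx); case: (g x) => [r| |]//=; last first.
      by move=> _; exact: leNye.
    rewrite !lee_fin => r0; have := ler_norm M; lra.
have fn : (\int[mu]_(x in D) f^\- x = +oo)%E.
  suff : (+oo <= \int[mu]_(x in D) f^\- x + `|M|%:E)%E.
    by rewrite leye_eq; case: (\int[mu]_(x in D) f^\- x)%E.
  rewrite -goo -[X in (_ <= _ + X)%E](iM `|M|) -ge0_integralD//; last first.
    by apply: measurable_funeneg.
  apply: ge0_le_integral => //.
    by apply: emeasurable_funD => //; apply: measurable_funeneg.
  move=> x Dx; rewrite funenegE.
  rewrite /f; move: (g0 x Dx); case: (g x) => [r| |] /= r0.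
  - rewrite -?EFinN -EFin_max -EFinD lee_fin; rewrite lee_fin in r0.
    have := ler_norm M; have : - (M - r) <= Num.max (- (M - r)) 0.
      by rewrite le_max lexx.
    lra.
  - by rewrite /= maxye.
  - by [].
rewrite fn.
have fpf : (\int[mu]_(x in D) f^\+ x)%E \is a fin_num.
  rewrite ge0_fin_numE ?(le_lt_trans fp) ?ltry//.
  by apply: integral_ge0.
by rewrite -(fineK fpf).
Qed.

Lemma lneE_gap (R : realType) (M : R) (z w : R[i]) :
  cmod (z - w) <= expR M ->
  lne (cmod (z - w))%:E = (M%:E - gap M z w)%E.
Proof.
rewrite /gap; set a := cmod _ => aM.
have [a0|a0] := leP a 0; first by rewrite le0_lneNy//= ?maxey.
rewrite lne_EFin// -EFinB -EFin_max -EFinB; congr EFin.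
rewrite max_r ?subKr// subr_ge0.
by rewrite -ler_expR lnK ?posrE.
Qed.

Definition mutual_gap (R : realType) (M : R) (mu : probability (borelC R) R) :=
  (\int[mu]_z \int[mu]_w gap M (z : R[i]) (w : R[i]))%E.

Lemma mutual_gap_ge0 (R : realType) (M : R) (mu : probability (borelC R) R) :
  (0 <= mutual_gap M mu)%E.
Proof.
by apply: integral_ge0 => z _; apply: integral_ge0 => w _; exact: gap_ge0.
Qed.

(** The restriction of both integrals to [K] disappears since [~` K] is a null
    set and the kernel is nonnegative. *)
Lemma log_energyE (R : realType) (K : set R[i]) (M : R)
    (mu : probability (borelC R) R) :
  measurable (K : set (borelC R)) -> prob_on K mu ->
  (forall z w, K z -> K w -> cmod (z - w) <= expR M) ->
  log_energy K mu = (M%:E - mutual_gap M mu)%E.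
Proof.
move=> mK muK KM.
have muKC : mu (~` (K : set (borelC R))) = 0%E.
  by rewrite probability_setC// muK subee.
have intK (f : borelC R -> \bar R) : measurable_fun setT f ->
    (forall x, 0 <= f x)%E -> (\int[mu]_(x in K) f x = \int[mu]_x f x)%E.
  move=> mf f0; rewrite [RHS](ge0_negligible_integral (measurableC mK))//.
  by rewrite setTD setCK.
have potE z : K z -> potential K mu z = (M%:E - \int[mu]_w gap M z w)%E.
  move=> Kz; rewrite /potential -intK; first last.
  - by move=> w; exact: gap_ge0.
  - exact: measurable_gapr.
  rewrite -integral_cstB//; first last.
  - by move=> w _; exact: gap_ge0.
  - apply: measurable_funS (@measurable_gapr R M z) => //.
  by apply: eq_integral => w; rewrite inE => Kw; rewrite (lneE_gap (KM _ _ Kz Kw)).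
rewrite /log_energy /mutual_gap.
have I0 (z : borelC R) : (0 <= \int[mu]_w gap M z w)%E.
  by apply: integral_ge0 => w _; exact: gap_ge0.
rewrite -(intK (fun z => \int[mu]_w gap M z w)%E)//; last first.
  exact: measurable_int_gap.
rewrite -integral_cstB//; last first.
  apply: measurable_funS (@measurable_int_gap R M mu) => //.
by apply: eq_integral => z; rewrite inE => Kz; rewrite potE.
Qed.

(** The kernel is [+oo] at [(L, L)], a point of positive [mu \x mu] mass. *)
Lemma mutual_gap_atom (R : realType) (M : R) (mu : probability (borelC R) R)
    (L : R[i]) : measurable ([set L] : set (borelC R)) ->
  mu [set L : borelC R] != 0%E -> mutual_gap M mu = +oo%E.
Proof.
move=> mL muL.
have muLgt : (0 < mu [set L : borelC R])%E by rewrite lt_neqAle eq_sym muL measure_ge0.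
have gLL : gap M L L = +oo%E.
  by rewrite /gap subrr le0_lneNy ?lee_fin ?cmodE ?raddf0 ?expr0n /= ?addr0 ?sqrtr0 ?maxey.
apply/eqP; rewrite -leye_eq.
have I0 (z : borelC R) : (0 <= \int[mu]_w gap M z w)%E.
  by apply: integral_ge0 => w _; exact: gap_ge0.
apply: (@le_trans _ _ (\int[mu]_(z in [set L : borelC R]) \int[mu]_w gap M z w)%E); last first.
  by apply: ge0_subset_integral => //; exact: measurable_int_gap.
rewrite (eq_integral (cst +oo%E)); last first.
  move=> z; rewrite inE /= => ->; apply/eqP; rewrite -leye_eq.
  apply: (@le_trans _ _ (\int[mu]_(w in [set L : borelC R]) gap M L w)%E); last first.
    apply: ge0_subset_integral => //; first exact: measurable_gapr.
    by move=> w _; exact: gap_ge0.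
  rewrite (eq_integral (cst +oo%E)); last by move=> w; rewrite inE /= => ->.
  by rewrite integral_cst// gt0_mulye.
by rewrite integral_cst// gt0_mulye.
Qed.

Lemma compact_measurable_borelC (R : realType) (K : set (Cplane R)) :
  compact K -> measurable (K : set (borelC R)).
Proof.
move=> cK; rewrite -[K]setCK; apply: (@measurableC _ (borelC R)).
by apply: sub_sigma_algebra; rewrite openC; apply: compact_closed => //; exact: norm_hausdorff.
Qed.

(** A probability measure on [K `|` [set L]] either has an atom at [L], and then
    its energy is [-oo], or is a probability measure on [K]. *)
Lemma capacity_setU1 (R : realType) (K : set (Cplane R)) (L : Cplane R) (M : R) :
  compact K ->
  (forall z w : R[i], (K `|` [set L]) z -> (K `|` [set L]) w ->
    cmod (z - w) <= expR M) ->
  capacity (K `|` [set L]) = capacity K.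
Proof.
move=> cK KM.
have mK := compact_measurable_borelC cK.
have mL : measurable ([set L] : set (borelC R)).
  exact: compact_measurable_borelC (@compact_set1 _ L).
have mKL : measurable ((K `|` [set L]) : set (borelC R)) by exact: measurableU.
have KM' (z w : R[i]) : K z -> K w -> cmod (z - w) <= expR M.
  by move=> Kz Kw; apply: KM; left.
congr expeR; apply/eqP; rewrite eq_le; apply/andP; split.
- apply: ge_ereal_sup => _ [mu muKL <-].
  rewrite (log_energyE mKL muKL KM).
  have [muL|muL] := eqVneq (mu [set L : borelC R]) 0%E; last first.
    by rewrite (mutual_gap_atom _ mL muL) leNye.
  have muK : prob_on K mu.
    by rewrite /prob_on /= -(measureU0 mK mL muL).
  by apply: ereal_sup_ubound; exists mu => //; rewrite (log_energyE mK muK KM').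
- apply: ereal_sup_le => _ [mu muK <-];
  have muKL : prob_on (K `|` [set L]) mu.
    apply/eqP; rewrite eq_le probability_le1//= -muK.
    by apply: le_measure; rewrite ?inE.
  by exists mu => //; rewrite (log_energyE mK muK KM') (log_energyE mKL muKL KM).
Qed.

(** * Scaling *)

Definition push (R : realType) d (T : measurableType d) (X : T -> borelC R)
    (mX : measurable_fun setT X) (P : probability T R) :
    probability (borelC R) R :=
  distribution P (HB.pack X (isMeasurableFun.Build _ _ _ _ X mX) : {mfun T >-> borelC R}).

Lemma mutual_gap_push (R : realType) d (T : measurableType d) (X : T -> borelC R)
    (mX : measurable_fun setT X) (P : probability T R) (M : R) :
  mutual_gap M (push mX P) =
  (\int[P]_x \int[P]_y gap M (X x : R[i]) (X y : R[i]))%E.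
Proof.
rewrite /mutual_gap /push ge0_integral_distribution/=; first last.
- by move=> z; apply: integral_ge0 => w _; exact: gap_ge0.
- exact: measurable_int_gap.
apply: eq_integral => x _.
rewrite /= ge0_integral_distribution//=.
- exact: measurable_gapr.
- by move=> w; exact: gap_ge0.
Qed.

Lemma measurable_scale (R : realType) (s : R) :
  measurable_fun setT (fun z : borelC R => s%:C * (z : R[i]) : borelC R).
Proof.
apply: continuous_measurable_borelC => z.
exact: (@scaler_continuous _ (Cplane R) s%:C z).
Qed.

Lemma cmodB_scale (R : realType) (s : R) (z w : R[i]) : 0 < s ->
  cmod (s%:C * z - s%:C * w) = s * cmod (z - w).
Proof.
move=> s0; rewrite -mulrBr cmodM {1}/cmod normc_def /=.
by rewrite expr0n /= addr0 sqrtr_sqr gtr0_norm.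
Qed.

Lemma gap_scale (R : realType) (s M : R) (z w : R[i]) : 0 < s ->
  gap (ln s + M) (s%:C * z) (s%:C * w) = gap M z w.
Proof.
move=> s0; rewrite /gap cmodB_scale//=.
congr (maxe _ _); set a := cmod _.
rewrite pmulr_rle0//; case: leP => [//|a0].
by rewrite -!EFinB lnM ?posrE//; congr EFin; ring.
Qed.

Definition scale (R : realType) (s : R) (K : set (Cplane R)) : set (Cplane R) :=
  [set s%:C * (z : R[i]) | z in K].

Lemma compact_scale (R : realType) (s : R) (K : set (Cplane R)) :
  compact K -> compact (scale s K).
Proof.
move=> cK; apply: continuous_compact => //.
apply: continuous_subspaceT => z.
exact: (@scaler_continuous _ (Cplane R) s%:C z).
Qed.

Lemma cmodB_scale_le (R : realType) (s M : R) (K : set (Cplane R)) : 0 < s ->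
  (forall z w : R[i], K z -> K w -> cmod (z - w) <= expR M) ->
  forall z w : R[i], scale s K z -> scale s K w ->
    cmod (z - w) <= expR (ln s + M).
Proof.
move=> s0 KM _ _ [z Kz <-] [w Kw <-].
by rewrite expRD lnK ?posrE// cmodB_scale// ler_pM2l// KM.
Qed.

Lemma log_energy_scale (R : realType) (s M : R) (K : set (Cplane R))
    (mu : probability (borelC R) R) : 0 < s -> compact K -> prob_on K mu ->
  (forall z w : R[i], K z -> K w -> cmod (z - w) <= expR M) ->
  exists2 nu, prob_on (scale s K) nu &
    log_energy (scale s K) nu = ((ln s)%:E + log_energy K mu)%E.
Proof.
move=> s0 cK muK KM.
have mK := compact_measurable_borelC cK.
have msK := compact_measurable_borelC (compact_scale (s := s) cK).
have sKM := cmodB_scale_le s0 KM.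
have nuK : prob_on (scale s K) (push (@measurable_scale R s) mu).
  apply/eqP; rewrite eq_le probability_le1//= -muK.
  apply: le_measure; rewrite ?inE//.
    by rewrite -[X in measurable X]setTI; exact: measurable_scale.
  by move=> z Kz; exists z.
exists (push (@measurable_scale R s) mu) => //.
rewrite (log_energyE mK muK KM) (log_energyE msK nuK sKM).
rewrite EFinD -addeA; congr (_ + (_ - _))%E.
rewrite mutual_gap_push; apply: eq_integral => z _; apply: eq_integral => w _.
exact: gap_scale.
Qed.

Lemma scaleK (R : realType) (s : R) (K : set (Cplane R)) : s != 0 ->
  scale s^-1 (scale s K) = K.
Proof.
move=> s0; have sK (z : R[i]) : s^-1%:C * (s%:C * z) = z.
  by rewrite mulrA -rmorphM mulVf// rmorph1 mul1r.
apply/seteqP; split => [_ [_ [z Kz <-] <-]|z Kz]; first by rewrite sK.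
by exists (s%:C * z); [exists z|rewrite sK].
Qed.

(** Pushing measures forward by the scaling adds [ln s] to the energies, hence
    to their supremum at least; scaling back by [s^-1] gives the converse. *)
Lemma capacity_scale (R : realType) (s M : R) (K : set (Cplane R)) :
  0 < s -> compact K ->
  (forall z w : R[i], K z -> K w -> cmod (z - w) <= expR M) ->
  capacity (scale s K) = (s%:E * capacity K)%E.
Proof.
move=> s0 cK KM.
have sKM := cmodB_scale_le s0 KM.
have half (r N : R) (A : set (Cplane R)) : 0 < r -> compact A ->
    (forall z w : R[i], A z -> A w -> cmod (z - w) <= expR N) ->
    ((ln r)%:E + ereal_sup [set log_energy A mu | mu in prob_on A] <=
     ereal_sup [set log_energy (scale r A) mu | mu in prob_on (scale r A)])%E.
  move=> r0 cA AN; rewrite addeC -leeBrDr//.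
  apply: ge_ereal_sup => _ [mu muA <-]; rewrite leeBrDr// addeC.
  have [nu nuA <-] := log_energy_scale r0 cA muA AN.
  by apply: ereal_sup_ubound; exists nu.
rewrite /capacity -[s in RHS](lnK (x := s)) ?posrE//.
rewrite -[((expR _)%:E)%E]/(expeR (ln s)%:E) -expeRD; congr expeR.
apply/eqP; rewrite eq_le (half s M K)// andbT.
have := half s^-1 _ _ _ (compact_scale (s := s) cK) sKM.
rewrite invr_gt0 scaleK ?gt_eqF// lnV ?posrE// => /(_ s0).
by rewrite EFinN addeC leeBlDr// addeC.
Qed.

(** * Self-similarity of the uniform law *)

(** Both sides are measures in [A], so it is enough to compare them on the
    intervals [`]c, d]]. *)
Lemma lebesgue_measure_affine (R : realType) (a b : R) (A : set (measurableTypeR R)) :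
  0 < a -> measurable A ->
  lebesgue_measure A =
  (a%:E * lebesgue_measure ((fun x : R => (a * x + b)%R) @^-1` A))%E.
Proof.
move=> a0 mA.
pose phi (x : measurableTypeR R) : measurableTypeR R := a * x + b.
have mf : measurable_fun setT phi.
  by apply: measurable_funD => //; apply: measurable_funM.
pose f : {mfun measurableTypeR R >-> measurableTypeR R} :=
  HB.pack phi (isMeasurableFun.Build _ _ _ _ phi mf).
pose k : {nonneg R} := NngNum (ltW a0).
have := @lebesgue_measure_unique R (mscale k (pushforward lebesgue_measure f)).
move=> ->//= _ [[c d]] _ <-.
rewrite /mscale /= /pushforward /=.
rewrite (_ : _ @^-1` _ = `](c - b) / a, (d - b) / a]%classic); last first.
  apply/seteqP; split => x /=; rewrite !in_itv /= ltr_pdivrMr// ler_pdivlMr//.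
    by rewrite ltrBlDr lerBrDr (mulrC x).
  by rewrite ltrBlDr lerBrDr (mulrC x).
rewrite !lebesgue_measure_itv /= !lte_fin ltr_pM2r ?invr_gt0// ltrD2r.
case: ifPn => _; last by rewrite mule0.
by rewrite -!EFinB -EFinM; congr EFin; field; rewrite gt_eqF.
Qed.

Lemma ge0_integral_affine (R : realType) (a b : R) (D : set (measurableTypeR R))
    (G : measurableTypeR R -> \bar R) :
  0 < a -> measurable D -> measurable_fun setT G -> (forall x, 0 <= G x)%E ->
  (\int[lebesgue_measure]_(x in D) G x = a%:E *
   \int[lebesgue_measure]_(x in (fun x : R => (a * x + b)%R) @^-1` D) G (a * x + b)%R)%E.
Proof.
move=> a0 mD mG G0.
pose phi (x : measurableTypeR R) : measurableTypeR R := a * x + b.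
have mf : measurable_fun setT phi.
  by apply: measurable_funD => //; apply: measurable_funM.
pose f : {mfun measurableTypeR R >-> measurableTypeR R} :=
  HB.pack phi (isMeasurableFun.Build _ _ _ _ phi mf).
pose k : {nonneg R} := NngNum (ltW a0).
rewrite (eq_measure_integral (mscale k (pushforward lebesgue_measure f))); last first.
  by move=> A mA _; exact: (lebesgue_measure_affine b a0 mA).
rewrite ge0_integral_mscale//; last exact: measurable_funTS.
by rewrite ge0_integral_pushforward//; exact: measurable_funTS.
Qed.

(** Self-similarity of the uniform law: if [x] is uniform on [[0, 1]] then
    choosing with equal chances [x / 2] or [x / 2 + 1 / 2] is again uniform.
    Through [x |-> exp(2 i pi x)] the two choices are the two square roots of a
    uniform point of the circle. *)
Lemma integral_uniform_dyadic (R : realType) (G : R -> \bar R) :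
  measurable_fun setT G -> (forall x, 0 <= G x)%E ->
  (\int[uniform_prob (@ltr01 R)]_x G x = 2^-1%:E *
   \int[uniform_prob (@ltr01 R)]_x (G (x / 2)%R + G (x / 2 + 1 / 2)%R))%E.
Proof.
move=> mG G0.
have mG1 : measurable_fun setT (fun x : R => G (x / 2)).
  by apply: measurableT_comp => //; apply: measurable_funM.
have mG2 : measurable_fun setT (fun x : R => G (x / 2 + 1 / 2)).
  apply: measurableT_comp => //; apply: measurable_funD => //; apply: measurable_funM => //.
rewrite !integral_uniform//; last 2 first.
- by apply: emeasurable_funD.
- by move=> x; rewrite adde_ge0.
rewrite subr0 invr1 !mul1e ge0_integralD//; last 2 first.
- exact: measurable_funTS.
- exact: measurable_funTS.
rewrite ge0_muleDr ?integral_ge0//.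
rewrite [X in (\int[_]_(x in X) _ = _)%E](_ : _ = `[0, 1/2]%classic `|` `]1/2, 1]%classic); last first.
  apply/seteqP; split => x /=; rewrite !in_itv/=.
    by move=> /andP[x0 x1]; have [?|?] := leP x (1/2); [left|right]; apply/andP; split; lra.
  by move=> [] /andP[? ?]; apply/andP; split; lra.
rewrite ge0_integral_setU//; last 2 first.
- exact: measurable_funTS.
- rewrite disj_set2E; apply/eqP/seteqP; split => // x [] /=.
  by rewrite !in_itv/= => /andP[_ +] /andP[+ _]; lra.
congr (_ + _)%E.
- rewrite (@ge0_integral_affine _ 2^-1 0)//.
  congr (_ * _)%E.
  rewrite (_ : _ @^-1` _ = `[0, 1]%classic); last first.
    by apply/seteqP; split => x /=; rewrite !in_itv/= => /andP[? ?]; apply/andP; split; lra.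
  by apply: eq_integral => x _; rewrite addr0 mulrC.
- rewrite (@ge0_integral_affine _ 2^-1 (1 / 2))//.
  congr (_ * _)%E.
  rewrite (_ : _ @^-1` _ = `]0, 1]%classic); last first.
    by apply/seteqP; split => x /=; rewrite !in_itv/= => /andP[? ?]; apply/andP; split; lra.
  rewrite integral_itv_obnd_cbnd.
    by apply: eq_integral => x _; rewrite (mulrC x).
  rewrite (_ : (fun _ => _) = (fun x : R => G (x / 2 + 1 / 2))); last first.
    by apply/funext => x; rewrite (mulrC x).
  exact: measurable_funTS.
Qed.

(** * Energy of the unit circle *)

(** [expi x] is [exp(2 i pi x)]. *)
Definition expi (R : realType) (x : R) : Cplane R :=
  cos (pi *+ 2 * x) +i* sin (pi *+ 2 * x).

Lemma continuous_expi (R : realType) : continuous (@expi R).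
Proof.
apply: continuous_complex => x.
  apply: continuous_comp; last exact: continuous_cos.
  exact: mulrl_continuous.
apply: continuous_comp; last exact: continuous_sin.
exact: mulrl_continuous.
Qed.

Lemma measurable_expi (R : realType) :
  measurable_fun setT (@expi R : measurableTypeR R -> borelC R).
Proof.
apply: measurable_borelC => A oA; apply: open_measurable.
by apply: open_comp oA => x _; exact: continuous_expi.
Qed.

Lemma cmod_expi (R : realType) (x : R) : cmod (expi x) = 1.
Proof. by rewrite cmodE /= cos2Dsin2 sqrtr1. Qed.

Lemma expi_half_sqr (R : realType) (x : R) :
  (expi (x / 2) : R[i]) ^+ 2 = expi x.
Proof.
have -> : expi x = expi (x / 2 + x / 2) by congr expi; lra.
rewrite /expi mulrDr cosD sinD expr2; apply/eqP; rewrite eq_complex /=.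
by apply/andP; split; apply/eqP; ring.
Qed.

Lemma expiD_half (R : realType) (x : R) : expi (x + 1 / 2) = - (expi x : R[i]).
Proof.
rewrite /expi (_ : pi *+ 2 * (x + 1 / 2) = pi *+ 2 * x + pi); last first.
  by rewrite mulrDr div1r -[pi *+ 2]mulr_natr mulfK.
by rewrite cosDpi sinDpi.
Qed.

Definition circle (R : realType) : set (Cplane R) := @expi R @` `[0, 1].

Lemma compact_circle (R : realType) : compact (@circle R).
Proof.
apply: continuous_compact; last exact: segment_compact.
by apply: continuous_subspaceT; exact: continuous_expi.
Qed.

Lemma cmod_circle (R : realType) (z : R[i]) : circle z -> cmod z = 1.
Proof. by move=> [x _ <-]; exact: cmod_expi. Qed.

Lemma circle_diam (R : realType) (z w : R[i]) :
  circle z -> circle w -> cmod (z - w) <= expR (ln 2).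
Proof.
move=> /cmod_circle z1 /cmod_circle w1; rewrite lnK ?posrE//.
by rewrite (le_trans (cmodD _ _))// cmodN z1 w1.
Qed.

Lemma gap_le_ln2 (R : realType) (z w : R[i]) : 1 <= cmod (z - w) ->
  (gap (ln 2) z w <= (ln 2)%:E)%E.
Proof.
rewrite /gap; set q := cmod _ => q1.
rewrite lne_EFin ?(lt_le_trans _ q1)// -EFinB -EFin_max lee_fin ge_max.
by rewrite ln_ge0 ?ler1n// gerBl ln_ge0.
Qed.

(** Let [p = |a - b|] and [q = |a + b|]; as [p^2 + q^2 = 4], one of them, say
    [q], is at least [1], so that [u(q) = ln 2 - ln q] lies in [[0, ln 2]].
    Without truncation the two sides are equal since [|a^2 - b^2| = p q].
    If the right-hand minimum is [c], the left-hand side is at most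
    [c + u(q) <= c + ln 2]; otherwise the truncation only lowers the left-hand
    side. *)
Lemma min_gap_sqr (R : realType) (a b : R[i]) (c : R) : 0 <= c ->
  cmod a = 1 -> cmod b = 1 ->
  (mine (gap (ln 2) a b) c%:E + mine (gap (ln 2) a (- b)%R) c%:E <=
   mine (gap (ln 2) (a ^+ 2)%R (b ^+ 2)%R) c%:E + (ln 2)%:E)%E.
Proof.
move=> c0 a1 b1.
wlog q1 : b b1 / 1 <= cmod (a + b).
  move=> H; have [|] := leP 1 (cmod (a + b)); first exact: H.
  (* Exchange [b] and [- b]: [|a - b| >= 1] since [p^2 + q^2 = 4] and [q < 1]. *)
  move=> q1; have := H (- b); rewrite cmodN opprK sqrrN addeC; apply => //.
  have /eqP := sqr_cmod (a - b); have := sqr_cmod (a + b).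
  move: (sqr_cmod a) (sqr_cmod b); rewrite a1 b1 expr1n.
  case: a b {H a1 b1} q1 => [a1 a2] [b1 b2] /= q1 ea eb e1 /eqP e2.
  rewrite leNgt; apply/negP => q2.
  have := cmod_ge0 (a1 +i* a2 + b1 +i* b2).
  have := cmod_ge0 (a1 +i* a2 - b1 +i* b2).
  nra.
have gq : (gap (ln 2) a (- b)%R <= (ln 2)%:E)%E by rewrite gap_le_ln2// opprK.
have sq : cmod (a ^+ 2 - b ^+ 2) = cmod (a - b) * cmod (a + b).
  by rewrite subr_sqr cmodM.
have p2 : cmod (a - b) <= 2 by rewrite (le_trans (cmodD _ _))// cmodN a1 b1.
have q2 : cmod (a + b) <= 2 by rewrite (le_trans (cmodD _ _))// a1 b1.
move: gq; rewrite /gap sq => gq.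
move: p2 q1 q2 gq (cmod_ge0 (a - b)); rewrite opprK.
move: (cmod (a - b)) (cmod (a + b)) => p q p2 q1 q2 gq p0.
have [p_le0|p_gt0] := leP p 0.
  have -> : p = 0 by apply/le_anti/andP.
  rewrite mul0r le0_lneNy//= maxey ?leNye// min_r ?leey//.
  by rewrite leeD2l// (le_trans _ gq)// ge_min lexx.
have q_gt0 : 0 < q by lra.
have lq : 0 <= ln q by rewrite ln_ge0.
have lq2 : ln q <= ln 2 by rewrite ler_ln ?posrE.
have lp2 : ln p <= ln 2 by rewrite ler_ln ?posrE.
rewrite !lne_EFin ?mulr_gt0// lnM ?posrE//.
rewrite -!EFinB -!EFin_max -!EFin_min -!EFinD lee_fin.
rewrite (max_r (y := ln 2 - ln p)) ?subr_ge0// (max_r (y := ln 2 - ln q)) ?subr_ge0//.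
by case: (leP 0 (ln 2 - (ln p + ln q))) => ?; rewrite !minEle;
  do 3 (case: ifPn; rewrite -?ltNge => ?); lra.
Qed.

Definition uniform01 (R : realType) : probability (measurableTypeR R) R :=
  uniform_prob (@ltr01 R).

Lemma integral_cst_uniform01 (R : realType) (k : R) :
  (\int[uniform01 R]_x k%:E = k%:E)%E.
Proof.
rewrite (integral_cst (uniform01 R) measurableT k%:E).
by rewrite [X in (_ * X)%E](@probability_setT _ _ _ (uniform01 R)) mule1.
Qed.

(** The truncation makes the double integral finite, so that it can be
    subtracted on both sides of an inequality. *)
Definition trunc_gap (R : realType) (n : nat) (x y : R) : \bar R :=
  mine (gap (ln 2) (expi x) (expi y)) n%:R%:E.

Lemma trunc_gap_ge0 (R : realType) n (x y : R) : (0 <= trunc_gap n x y)%E.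
Proof. by rewrite /trunc_gap le_min gap_ge0 lee_fin ler0n. Qed.

Lemma measurable_gap_expi (R : realType) (M : R) :
  measurable_fun setT (fun p : measurableTypeR R * measurableTypeR R =>
    gap M (expi p.1) (expi p.2)).
Proof.
have mc := @measurable_expi R.
have mh : measurable_fun setT (fun p : measurableTypeR R * measurableTypeR R =>
    (expi p.1, expi p.2) : borelC R * borelC R).
  apply: measurable_fun_pair.
  - exact: measurableT_comp mc measurable_fst.
  - exact: measurableT_comp mc measurable_snd.
exact: (measurableT_comp (@measurable_gap R M) mh).
Qed.

Lemma measurable_trunc_gap (R : realType) n :
  measurable_fun setT (fun p : measurableTypeR R * measurableTypeR R => trunc_gap n p.1 p.2).
Proof. by apply: measurable_mine => //; exact: measurable_gap_expi. Qed.

Lemma measurable_trunc_gapr (R : realType) n (x : R) :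
  measurable_fun setT (trunc_gap n x : measurableTypeR R -> \bar R).
Proof.
have := @measurable_fun_pair2 _ _ _ (measurableTypeR R) (measurableTypeR R) _ _ x (@measurable_trunc_gap R n).
exact.
Qed.

Lemma measurable_int_trunc_gap (R : realType) n :
  measurable_fun setT (fun x : measurableTypeR R => \int[uniform01 R]_y trunc_gap n x y)%E.
Proof.
apply: (@measurable_fun_fubini_tonelli_F _ _ _ _ R (uniform01 R) _ (@measurable_trunc_gap R n)).
by move=> p; exact: trunc_gap_ge0.
Qed.

(** With [a] and [b] the square roots [expi (x / 2)] and [expi (y / 2)], the
    four pairs of square roots [(+-a, +-b)] are involved on the left; by the
    symmetry of the kernel under [(z, w) |-> (- z, - w)] only [(a, b)] and
    [(a, - b)] matter, and min_gap_sqr compares them with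
    [(a^2, b^2) = (expi x, expi y)]. *)
Lemma int_trunc_gap_half (R : realType) n (x : R) :
  (\int[uniform01 R]_y trunc_gap n (x / 2)%R y + \int[uniform01 R]_y trunc_gap n (x / 2 + 1 / 2)%R y
    <= \int[uniform01 R]_y trunc_gap n x y + (ln 2)%:E)%E.
Proof.
pose X := (\int[uniform01 R]_y (trunc_gap n (x / 2)%R (y / 2)%R + trunc_gap n (x / 2)%R (y / 2 + 1 / 2)%R))%E.
have mt (z b : R) : measurable_fun setT (fun y : measurableTypeR R => trunc_gap n z (y / 2 + b)).
  apply: (measurableT_comp (@measurable_trunc_gapr R n z)).
  by apply: measurable_funD => //; apply: measurable_funM.
have mt0 (z : R) : measurable_fun setT (fun y : measurableTypeR R => trunc_gap n z (y / 2)).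
  apply: (measurableT_comp (@measurable_trunc_gapr R n z)).
  by apply: measurable_funM.
have X0 : (0 <= X)%E by apply: integral_ge0 => y _; rewrite adde_ge0 ?trunc_gap_ge0.
have E (z : R) : (\int[uniform01 R]_y trunc_gap n z y = 2^-1%:E *
    \int[uniform01 R]_y (trunc_gap n z (y / 2)%R + trunc_gap n z (y / 2 + 1 / 2)%R))%E.
  by apply: integral_uniform_dyadic; [exact: measurable_trunc_gapr|move=> y; exact: trunc_gap_ge0].
have -> : (\int[uniform01 R]_y trunc_gap n (x / 2 + 1 / 2)%R y = 2^-1%:E * X)%E.
  rewrite E; congr (_ * _)%E; apply: eq_integral => y _.
  rewrite addeC /trunc_gap !expiD_half /gap opprK.
  congr (mine (maxe _ (_ - lne _%:E)) _ + mine (maxe _ (_ - lne _%:E)) _)%E.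
    by rewrite -[LHS]cmodN opprD !opprK.
  by rewrite -[LHS]cmodN opprD !opprK.
rewrite E -/X -ge0_muleDl// -EFinD (_ : 2^-1 + 2^-1 = 1) ?mul1e; [|by lra].
rewrite -[in leRHS](integral_cst_uniform01 (ln 2)).
rewrite -ge0_integralD//; last 3 first.
- by move=> y _; exact: trunc_gap_ge0.
- exact: measurable_trunc_gapr.
- by move=> y _; rewrite lee_fin ln_ge0// ler1n.
apply: ge0_le_integral => //.
- by move=> y _; rewrite adde_ge0 ?trunc_gap_ge0.
- exact: emeasurable_funD.
- by apply: emeasurable_funD => //; exact: measurable_trunc_gapr.
move=> y _; rewrite /trunc_gap !expiD_half -(expi_half_sqr x) -(expi_half_sqr y).
by apply: min_gap_sqr; rewrite ?cmod_expi.
Qed.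

(** Integrating the previous inequality over [x] gives [V <= (V + ln 2) / 2]
    for the left-hand side [V], which is finite. *)
Lemma int_trunc_gap_le (R : realType) n :
  (\int[uniform01 R]_x \int[uniform01 R]_y trunc_gap n x y <= (ln 2)%:E)%E.
Proof.
set V := (X in (X <= _)%E).
have I0 (x : R) : (0 <= \int[uniform01 R]_y trunc_gap n x y)%E.
  by apply: integral_ge0 => y _; exact: trunc_gap_ge0.
have V0 : (0 <= V)%E by apply: integral_ge0 => x _; exact: I0.
have In (x : R) : (\int[uniform01 R]_y trunc_gap n x y <= n%:R%:E)%E.
  rewrite -(integral_cst_uniform01 n%:R).
  apply: ge0_le_integral => //.
  - by move=> y _; exact: trunc_gap_ge0.
  - exact: measurable_trunc_gapr.
  - by move=> y _; rewrite /trunc_gap ge_min lexx orbT.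
have Vn : (V <= n%:R%:E)%E.
  rewrite -(integral_cst_uniform01 n%:R).
  apply: ge0_le_integral => //.
  exact: measurable_int_trunc_gap.
have Vfin : V \is a fin_num by rewrite ge0_fin_numE// (le_lt_trans Vn)// ltry.
have VV : (V <= 2^-1%:E * (V + (ln 2)%:E))%E.
  rewrite {1}/V (integral_uniform_dyadic (@measurable_int_trunc_gap R n) I0).
  rewrite lee_pmul2l ?lte_fin ?invr_gt0//.
  rewrite -[in leRHS](integral_cst_uniform01 (ln 2)).
  rewrite -ge0_integralD//; last 2 first.
  - exact: measurable_int_trunc_gap.
  - by move=> y _; rewrite lee_fin ln_ge0// ler1n.
  apply: ge0_le_integral => //.
  - by move=> x _; rewrite adde_ge0.
  - apply: emeasurable_funD; apply: (measurableT_comp (@measurable_int_trunc_gap R n)).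
      by apply: measurable_funM.
    by apply: measurable_funD => //; apply: measurable_funM.
  - by apply: emeasurable_funD => //; exact: measurable_int_trunc_gap.
  by move=> x _; exact: int_trunc_gap_half.
move: VV; rewrite -(fineK Vfin) -EFinD -EFinM !lee_fin; lra.
Qed.

Lemma cvg_mine_natr (R : realType) (a : \bar R) : (0 <= a)%E ->
  limn (fun n => mine a n%:R%:E) = a.
Proof.
move=> a0; apply/cvg_lim => //; case: a a0 => [r r0| _|//].
- apply: cvg_near_cst; near=> n; apply: min_l; rewrite lee_fin.
  by near: n; exact: nbhs_infty_ger.
- under eq_fun do rewrite minye.
  by apply/cvgeryP; exact: cvgr_idn.
Unshelve. all: by end_near. Qed.

Lemma nd_mine_natr (R : realType) (a : \bar R) :
  nondecreasing_seq (fun n => mine a n%:R%:E).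
Proof.
move=> m n mn; rewrite le_min !ge_min lexx /= lee_fin ler_nat mn orbT.
by [].
Qed.

(** The bound on the truncated kernels does not depend on [n], so it passes to
    the limit by monotone convergence. *)
Lemma int_gap_expi_le (R : realType) :
  (\int[uniform01 R]_x \int[uniform01 R]_y gap (ln 2) (expi x) (expi y) <= (ln 2)%:E)%E.
Proof.
have nd (x y : R) : nondecreasing_seq (fun n => trunc_gap n x y) by exact: nd_mine_natr.
have ndI (x : R) : nondecreasing_seq (fun n => \int[uniform01 R]_y trunc_gap n x y)%E.
  move=> m n mn; apply: ge0_le_integral => //.
  - by move=> y _; exact: trunc_gap_ge0.
  - exact: measurable_trunc_gapr.
  - exact: measurable_trunc_gapr.
  - by move=> y _; exact: nd.
have I0 n (x : R) : (0 <= \int[uniform01 R]_y trunc_gap n x y)%E.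
  by apply: integral_ge0 => y _; exact: trunc_gap_ge0.
have inner (x : R) : (\int[uniform01 R]_y gap (ln 2) (expi x) (expi y) =
    limn (fun n => \int[uniform01 R]_y trunc_gap n x y))%E.
  rewrite -monotone_convergence//.
  - by apply: eq_integral => y _; rewrite cvg_mine_natr// gap_ge0.
  - by move=> n; exact: measurable_trunc_gapr.
  - by move=> n y _; exact: trunc_gap_ge0.
under eq_integral do rewrite inner.
rewrite monotone_convergence//; first last.
- by move=> n; exact: measurable_int_trunc_gap.
apply: lime_le.
  apply: ereal_nondecreasing_is_cvgn => m n mn; apply: ge0_le_integral => //.
  - exact: measurable_int_trunc_gap.
  - exact: measurable_int_trunc_gap.
  - by move=> x _; exact: ndI.
by apply: nearW => n; exact: int_trunc_gap_le.
Qed.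

(** All energies are at most [ln 2] because the diameter is [2], and the energy
    of the normalized arc length is at least [0]. *)
Lemma capacity_circle (R : realType) :
  exists2 c : R, capacity (@circle R) = c%:E & 1 <= c.
Proof.
have mS := compact_measurable_borelC (@compact_circle R).
pose s := push (@measurable_expi R) (uniform01 R).
have sS : prob_on (@circle R) s.
  apply: integral_uniform_pdf1; first exact: ltr01.
  by move=> x x01; exists x.
set E := [set log_energy (@circle R) mu | mu in prob_on (@circle R)].
have Eub : (ereal_sup E <= (ln 2)%:E)%E.
  apply: ge_ereal_sup => _ [mu muS <-].
  rewrite (log_energyE mS muS (@circle_diam R)).
  by move: (mutual_gap_ge0 (ln 2) mu); case: mutual_gap => [r| |] //= r0;
    rewrite ?leNye// -EFinB lee_fin gerBl.
have Elb : (0 <= ereal_sup E)%E.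
  apply: (@le_trans _ _ (log_energy (@circle R) s)); last first.
    by apply: ereal_sup_ubound; exists s.
  rewrite (log_energyE mS sS (@circle_diam R)) mutual_gap_push.
  rewrite sube_ge0 ?orbT//.
  exact: int_gap_expi_le.
have Efin : ereal_sup E \is a fin_num.
  rewrite ge0_fin_numE//. exact: le_lt_trans Eub (ltry _).
exists (expR (fine (ereal_sup E))); last by rewrite -expR0 ler_expR fine_ge0.
by rewrite /capacity -/E -{1}(fineK Efin).
Qed.

(** * Two sets of the same capacity *)

Theorem mainTheorem3 (R : realType) (t : R) (t_gt0 : 0 < t) (t_lt1 : t < 1) :
  exists K1 K2 : set (Cplane R),
    [/\ compact K1, compact K2,
        capacity K1 = t%:E, capacity K2 = t%:E & theta K1 <> theta K2].
Proof.
have [c cE c1] := capacity_circle R.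
have c0 : 0 < c by rewrite (lt_le_trans _ c1).
pose s := t / c.
have s0 : 0 < s by rewrite divr_gt0.
have s1 : s < 1 by rewrite ltr_pdivrMr// mul1r (lt_le_trans t_lt1).
(* With this [r], theta K' <= 8 r^2 < 9 r^2 = (1 - s)^2 <= theta K. *)
pose r := (1 - s) / 3.
have r0 : 0 < r by rewrite divr_gt0// subr_gt0.
pose L := s + 2 / r.
have L0 : 0 < L by rewrite addr_gt0// divr_gt0.
pose K : set (Cplane R) := scale s (@circle R).
have cK : compact K by apply: compact_scale; exact: compact_circle.
have capK : capacity K = t%:E.
  rewrite /K (capacity_scale s0 (@compact_circle R) (@circle_diam R)) cE.
  by rewrite -EFinM divfK// gt_eqF.
have Ks (z : R[i]) : K z -> cmod z <= s.
  move=> [w /cmod_circle w1 <-]; rewrite -[_ * w]subr0 -(mulr0 s%:C).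
  by rewrite cmodB_scale// subr0 w1 mulr1.
have cmodL : cmod L%:C = L by rewrite cmodE /= expr0n addr0 sqrtr_sqr gtr0_norm.
pose K' : set (Cplane R) := K `|` [set L%:C].
have K'L (z : R[i]) : K' z -> cmod z <= 1 + L.
  by move=> [/Ks zs|->]; [lra|rewrite cmodL; lra].
exists K, K'; split => //.
- by rewrite /K'; apply: compactU => //; exact: compact_set1.
- rewrite -capK; apply: (@capacity_setU1 _ _ _ (ln ((1 + L) + (1 + L)))) => //.
  move=> z w /K'L zL /K'L wL; rewrite lnK ?posrE; last lra.
  by rewrite (le_trans (cmodD _ _))// cmodN lerD.
have Kss : K s%:C.
  exists (expi 0); first by exists 0 => //=; rewrite in_itv /= lexx ler01.
  by rewrite /expi mulr0 cos0 sin0 mulr1.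
move=> thK; have := theta_ge s1 Ks; rewrite leNgt => /negP; apply.
rewrite thK (@le_lt_trans _ _ (8 * r ^+ 2)%:E)//; last first.
  have -> : 1 - s = 3 * r by rewrite /r mulrC divfK.
  rewrite lte_fin (_ : (3 * r) ^+ 2 = 9 * r ^+ 2); last by ring.
  by rewrite ltr_pM2r ?exprn_gt0//; lra.
apply: (@theta_le _ _ s%:C L%:C) => //; last by right.
  rewrite -rmorphB /= cmodE /= expr0n addr0 sqrtr_sqr /L opprD addNKr normrN.
  have r20 : 0 < 2 / r by exact: divr_gt0.
  by rewrite gtr0_norm// mulrC divfK// gt_eqF.
by left.
Qed.
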